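(* Let $(\mathbb{R},\mathcal{C})$ be any perfect base. Then every abundant Baire set $E\subseteq\mathbb{R}$ (abundant and Baire with respect to $(\mathbb{R},\mathcal{C})$) contains an ARD set $F$ which is a full subset of $E$ in $(\mathbb{R},\mathcal{C})$.
   Context: **Category base.** A pair $(X,\mathcal{C})$, where $X$ is a non-empty set and $\mathcal{C}$ is a family of subsets of $X$, is a category base if the non-empty members of $\mathcal{C}$, called regions, satisfy: (1) every point of $X$ belongs to some region, i.e. $X=\bigcup\mathcal{C}$; (2) if $A$ is a region and $\mathcal{D}$ is any non-empty family of disjoint regions having cardinality less than the cardinality of $\mathcal{C}$, then (i) if $A\cap(\bigcup\mathcal{D})$ contains a region, there is a region $D\in\mathcal{D}$ such that $A\cap D$ contains a region; (ii) if $A\cap(\bigcup\mathcal{D})$ contains no region, there is a region $B\subseteq A$ which is disjoint from every region in $\mathcal{D}$. A subregion of a region $A$ is a region contained in $A$. **Singular, meager, abundant, Baire.** In a category base $(X,\mathcal{C})$, a set $A\subseteq X$ is singular if every region contains a subregion disjoint from $A$; meager if it is a countable union of singular sets; abundant if it is not meager; Baire if every region contains a subregion in which $A$ or its complement is meager (i.e. a subregion $D$ such that $D\cap A$ or $D\setminus A$ is meager). **Perfect base.** A category base $(X,\mathcal{C})$ is perfect (a perfect base) if $X=\mathbb{R}^m$ for some $m$ (here $m=1$) and for every region $A$ and every point $x\in A$ there is a descending sequence $\{A_n\}_{n=1}^{\infty}$ of regions such that $x\in A_n$ and $\operatorname{diam}(A_n)\le 1/n$ for $n=1,2,\dots$.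 **ARD set.** A subset of $\mathbb{R}^m$ is ARD (''a set avoiding rational distance'') if the Euclidean distance between any two distinct points of it is always an irrational number. **Full subset.** In a category base $(X,\mathcal{C})$, a set $F$ is a full subset of $E$ if $F\subseteq E$ and for every Baire set $B$, $B\cap F$ is abundant whenever $B\cap E$ is abundant.
   Formalization: A perfect base is additionally required to have all its regions perfect sets (closed, no isolated points) and the descending sequence A_n attached to A and x to consist of subregions of A; with either requirement dropped the claim fails (e.g. all singletons as regions). *)

(* Defs.v *)
From HB Require Import structures.
From mathcomp Require Import all_boot all_order all_algebra.
From mathcomp Require Import all_classical all_reals all_analysis.

Set Implicit Arguments.
Unset Strict Implicit.
Unset Printing Implicit Defensive.

Import Order.TTheory GRing.Theory Num.Theory.
Import numFieldNormedType.Exports.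

Local Open Scope classical_set_scope.
Local Open Scope ring_scope.

(* The ground set X of a category base is the whole type T. *)

Definition region (T : Type) (C : set (set T)) (A : set T) : Prop :=
  C A /\ A !=set0.

Definition contains_region (T : Type) (C : set (set T)) (A : set T) : Prop :=
  exists2 B : set T, region C B & B `<=` A.

Definition card_lt (T U : Type) (A : set T) (B : set U) : Prop :=
  (A #<= B)%card /\ ~ (B #<= A)%card.

(* [\bigcup_(D in DD) D] is the union of the family [DD]; the cardinality
   bound refers to the whole family [C], whose empty member, if any, is not
   a region. *)
Definition category_base (T : Type) (C : set (set T)) : Prop :=
  [/\ [set: T] !=set0,
      \bigcup_(A in C) A = [set: T] &
      forall (A : set T) (DD : set (set T)),
        region C A ->
        DD !=set0 -> DD `<=` region C -> trivIset DD id -> card_lt DD C ->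
        (contains_region C (A `&` \bigcup_(D in DD) D) ->
           exists2 D : set T, DD D & contains_region C (A `&` D)) /\
        (~ contains_region C (A `&` \bigcup_(D in DD) D) ->
           exists B : set T,
             [/\ region C B, B `<=` A &
                 forall D : set T, DD D -> B `&` D = set0])].

Definition singular (T : Type) (C : set (set T)) (S : set T) : Prop :=
  forall A : set T, region C A ->
    exists B : set T, [/\ region C B, B `<=` A & B `&` S = set0].

(* The empty set is singular, so that sequences of singular sets also account
   for finite unions. *)
Definition meager (T : Type) (C : set (set T)) (S : set T) : Prop :=
  exists2 F : nat -> set T,
    (forall n, singular C (F n)) & S = \bigcup_n F n.

Definition abundant (T : Type) (C : set (set T)) (S : set T) : Prop :=
  ~ meager C S.

Definition baire (T : Type) (C : set (set T)) (S : set T) : Prop :=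
  forall A : set T, region C A ->
    exists D : set T,
      [/\ region C D, D `<=` A & meager C (D `&` S) \/ meager C (D `\` S)].

Definition full_subset (T : Type) (C : set (set T)) (F E : set T) : Prop :=
  F `<=` E /\
  forall B : set T,
    baire C B -> abundant C (B `&` E) -> abundant C (B `&` F).

Definition diam (R : realType) (A : set R) : \bar R :=
  ereal_sup [set e | exists x y : R, [/\ A x, A y & e = `|x - y|%:E]].

(* Morgan's notion on the real line: regions are perfect sets and the
   descending sequence attached to [A] and [x] consists of subregions of [A].
   Neither clause is redundant: without the first, the family of all
   singletons would qualify, for which every set is Baire, only set0 is
   meager, and every set is its only full subset; without the second, the two
   points 0 and 1 could be made abundant by adding, to rational intervals,
   small Cantor sets shrinking to 0 and to 1.
   [A_ n] stands for the (n+1)-st term of the sequence. *)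
Definition perfect_base (R : realType) (C : set (set R)) : Prop :=
  [/\ category_base C,
      forall A : set R, region C A -> perfect_set A &
      forall (A : set R) (x : R), region C A -> A x ->
        exists A_ : nat -> set R,
          [/\ forall n, region C (A_ n),
              forall n, A_ n `<=` A,
              forall n, A_ n.+1 `<=` A_ n,
              forall n, A_ n x &
              forall n, (diam (A_ n) <= (n.+1%:R^-1)%:E)%E]].

(* Set avoiding rational distances, in dimension one. *)
Definition ARD (R : realType) (F : set R) : Prop :=
  forall x y : R, F x -> F y -> x <> y -> @irrational R `|x - y|.

(* Main.v *)
(* A Bernstein construction. Recursion over a shortest well-order of the
   continuum picks, in every Cantor set contained in [E], a point at irrational
   distance from the points picked before; the result [F] is ARD and meets every
   Cantor subset of [E]. If [B] is Baire with [B `&` E] abundant, Banach's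
   category theorem gives a region [D] with [D `\` (B `&` E)] meager. Were
   [B `&` F] meager, a Cantor scheme of regions inside [D] avoiding both meager
   sets (the regions are perfect and shrink around their points) would produce a
   Cantor subset of [E] missing [F]. *)

Require Import Defs.
From Stdlib Require Import Wellfounded.
From HB Require Import structures.
From mathcomp Require Import all_boot all_order all_algebra.
From mathcomp Require Import all_classical all_reals all_analysis.
From mathcomp Require Import wochoice lra.

Set Implicit Arguments.
Unset Strict Implicit.
Unset Printing Implicit Defensive.

Import Order.TTheory GRing.Theory Num.Theory.
Import numFieldNormedType.Exports.

Local Open Scope classical_set_scope.
Local Open Scope ring_scope.

(** * Cardinal comparison and transfinite recursion *)

Lemma card_le_inj (T U : Type) (A : set T) (B : set U) (f : T -> U) :
  (forall x, A x -> B (f x)) ->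
  (forall x y, A x -> A y -> f x = f y -> x = y) -> (A #<= B)%card.
Proof.
move=> fB finj.
have : (f @` A #= A)%card.
  by apply: inj_card_eq => x y /set_mem Ax /set_mem Ay; exact: finj.
rewrite card_eq_le => /andP[_ /card_le_trans]; apply.
by apply: subset_card_le => _ [x Ax <-]; exact: fB.
Qed.

Lemma card_le_injP (T : Type) (U : pointedType) (A : set T) (B : set U) :
  (A #<= B)%card ->
  exists f : T -> U, (forall x, A x -> B (f x)) /\
    (forall x y, A x -> A y -> f x = f y -> x = y).
Proof.
move=> /pcard_leP[f]; exists f; split; first by move=> x; exact: funS.
by move=> x y Ax Ay; apply: inj; exact/mem_set.
Qed.

(* If some segment of an arbitrary well-order has the size of [A], pull the order
   back along an injection of [A] into the shortest such segment. *)
Lemma initial_well_order (T : pointedType) (A : set T) :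
  exists lt : T -> T -> Prop,
    [/\ well_founded lt,
        forall x y, A x -> A y -> [\/ lt x y, x = y | lt y x] &
        forall x, A x -> ~ (A #<= A `&` lt^~ x)%card].
Proof.
have [le le_wo] := well_ordering_principle T.
(* Least elements of pairs give totality of [le], and their uniqueness gives antisymmetry. *)
have memx (x y : T) : x \in pred2 x y by rewrite inE eqxx.
have memy (x y : T) : y \in pred2 x y by rewrite inE eqxx orbT.
have le_tot x y : le x y \/ le y x.
  have [z [[+ zmin] _]] := le_wo (pred2 x y) (ex_intro _ x (memx x y)).
  move: (zmin x (memx x y)) (zmin y (memy x y)) => zx zy.
  by move=> /orP[] /eqP zE; [left|right]; rewrite -{1}zE.
have le_anti x y : le x y -> le y x -> x = y.
  move=> xy yx; have rr z : le z z by case: (le_tot z z).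
  have [z [_ zuniq]] := le_wo (pred2 x y) (ex_intro _ x (memx x y)).
  have <- : z = x by apply: zuniq; split; rewrite ?memx ?memy// => w /orP[] /eqP ->.
  by apply: zuniq; split; rewrite ?memx ?memy// => w /orP[] /eqP ->.
pose lt x y := le x y /\ x <> y.
have least (P : set T) : P !=set0 -> exists2 z, P z & forall y, P y -> ~ lt y z.
  move=> [x Px].
  have [z [[/asboolP Pz zmin] _]] := le_wo (fun u => `[< P u >]) (ex_intro _ x (asboolT Px)).
  exists z => // y Py [yz]; apply; apply: le_anti => //; apply: zmin.
  exact: asboolT.
have lt_wf : well_founded lt.
  move=> x; apply: contrapT => nx.
  have [z nz zmin] := least [set u | ~ Acc lt u] (ex_intro _ x nx).
  apply: nz; constructor => y yz; apply: contrapT => ny; exact: (zmin y).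
have lt_tri x y : [\/ lt x y, x = y | lt y x].
  have [<-|/eqP xy] := eqVneq x y; first by constructor 2.
  case: (le_tot x y) => h; [constructor 1|constructor 3]; split=> //.
  exact/nesym.
have [[x Ax]|noseg] := pselect (exists x, (A #<= A `&` lt^~ x)%card); last first.
  by exists lt; split => // x _ Ax; apply: noseg; exists x.
have [z zle zmin] := least [set x | (A #<= A `&` lt^~ x)%card] (ex_intro _ x Ax).
have [f [fA finj]] := card_le_injP zle.
exists (fun u v => lt (f u) (f v)); split.
- exact: (wf_inverse_image _ _ _ f lt_wf).
- move=> u v Au Av; have [|fuv|] := lt_tri (f u) (f v).
  + by constructor 1.
  + by constructor 2; exact: finj.
  + by constructor 3.
(* [f] carries the predecessors of [u] in [A] to predecessors of [f u], so the segment at [f u]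
   would be as large as [A], although [f u] precedes [z]. *)
- move=> u Au Ale; apply: (zmin (f u)); last exact: (fA u Au).2.
  apply: card_le_trans Ale _; apply: (@card_le_inj _ _ _ _ f).
  + by move=> v [Av vu]; split=> //; exact: (fA v Av).1.
  + by move=> v w [Av _] [Aw _]; exact: finj.
Qed.

(* Transfinite recursion of length the cardinality of [A]: [S_ i] is the set of
   the values chosen before stage [i]. *)
Lemma transfinite_choice (I T : pointedType) (A : set I)
    (Q : I -> set T -> T -> Prop) :
  (forall i S, A i -> card_lt S A -> exists t, Q i S t) ->
  exists (f : I -> T) (S_ : I -> set T),
    [/\ forall i, A i -> Q i (S_ i) (f i),
        forall i, S_ i `<=` f @` A &
        forall i j, A i -> A j -> i <> j -> S_ j (f i) \/ S_ i (f j)].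
Proof.
move=> exQ; have [lt [lt_wf lt_tri lt_small]] := initial_well_order A.
pose step i (g : forall j, lt j i -> T) : T :=
  xget point (Q i [set t | exists j (h : lt j i), A j /\ g j h = t]).
pose f := Fix lt_wf (fun=> T) step.
have fE i : f i = xget point (Q i (f @` (A `&` lt^~ i))).
  rewrite /f Fix_eq.
    rewrite /step; congr (xget _ (Q _ _)); apply/seteqP; split=> t.
      by move=> [j [h [Aj <-]]]; exists j.
    by move=> [j [Aj h] <-]; exists j, h.
  move=> {}i g g' gg'; rewrite /step; congr (xget _ (Q _ _)).
  by apply/seteqP; split=> t [j [h [Aj <-]]]; exists j, h.
exists f, (fun i => f @` (A `&` lt^~ i)); split.
- move=> i Ai; rewrite fE; apply: xgetPex; apply: exQ => //; split.
    exact: card_le_trans (card_image_le _ _) (subset_card_le (@subIsetl _ _ _)).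
  move=> Ale; apply: (lt_small i Ai).
  exact: card_le_trans Ale (card_image_le _ _).
- by move=> i _ [j [Aj _] <-]; exists j.
- move=> i j Ai Aj ij; have [h||h] := lt_tri i j Ai Aj => //.
    by left; exists i.
  by right; exists j.
Qed.

(** * Meager sets and Banach's category theorem *)

Lemma singular_sub (T : Type) (C : set (set T)) (S S' : set T) :
  S' `<=` S -> singular C S -> singular C S'.
Proof.
move=> S'S sS A /sS[B [rB BA BS]]; exists B; split=> //.
by apply/seteqP; split=> // x [Bx /S'S Sx]; rewrite -BS.
Qed.

Lemma meager_sub (T : Type) (C : set (set T)) (S S' : set T) :
  S' `<=` S -> meager C S -> meager C S'.
Proof.
move=> S'S [F sF SE]; exists (fun n => F n `&` S').
  by move=> n; apply: singular_sub (sF n); exact: subIsetl.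
by rewrite -setI_bigcupl -SE; apply/esym/setIidr.
Qed.

Lemma meagerU (T : Type) (C : set (set T)) (S S' : set T) :
  meager C S -> meager C S' -> meager C (S `|` S').
Proof.
move=> [F sF ->] [G sG ->].
exists (fun n => if odd n then F n./2 else G n./2) => [n|]; first by case: odd.
apply/seteqP; split=> x.
  case=> -[n _ xn].
    by exists n.*2.+1 => //=; rewrite odd_double /= uphalf_double.
  by exists n.*2 => //=; rewrite odd_double half_double.
by move=> [n _]; case: odd => xn; [left|right]; exists n./2.
Qed.

(* Every region gets its turn in a recursion of length [#|C|], so that fewer
   than [#|C|] regions have been chosen by then and the category base axiom
   applies to them. *)
Lemma disjoint_refinement (T : Type) (C N : set (set T)) :
  category_base C -> N `<=` region C ->
  (forall A, region C A -> exists2 B, N B & B `<=` A) ->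
  exists M : set (set T),
    [/\ M `<=` N, trivIset M id &
        forall A, region C A -> exists2 B, M B & contains_region C (A `&` B)].
Proof.
move=> [_ _ baseC] NC Ndense.
(* Stage [A] records the empty set when there is nothing to add. The second clause is conditional
   because [A] may be empty and a value is demanded for every small [S], even one that never
   arises. *)
pose Q A (S : set (set T)) t :=
  (t = set0 \/ N t /\ forall s, S s -> t `&` s = set0) /\
  (region C A -> S `<=` N `|` [set set0] -> trivIset S id ->
    exists2 s, (s = t \/ S s) & contains_region C (A `&` s)).
have [A S CA [SleC nCleS]|f [S_ [fQ Sf trich]]] :=
    @transfinite_choice (set T) (set T) C Q.
  have [[rA SN Sdisj]|no] := pselect
      [/\ region C A, S `<=` N `|` [set set0] & trivIset S id]; last first.
    by exists set0; split; [left|move=> rA SN Sdisj; case: no].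
  have [[s Ss As]|noS] := pselect (exists2 s, S s & contains_region C (A `&` s)).
    by exists set0; split; [left|move=> _ _ _; exists s => //; right].
  suff [B [rB BA BS]] : exists B, [/\ region C B, B `<=` A &
      forall s, S s -> B `&` s = set0].
    have [t Nt tB] := Ndense _ rB; exists t; split.
      right; split => // s Ss; rewrite -subset0 -(BS s Ss); exact: setSI.
    move=> _ _ _; exists t; first by left.
    by exists t; [exact: NC|move=> x tx; split=> //; exact/BA/tB].
  (* The category base axiom speaks of nonempty families; if no member of [N] has been chosen yet,
     [A] itself is the required region. *)
  have [[t0 [St0 Nt0]]|S0] := pselect (S `&` N !=set0); last first.
    exists A; split=> // s Ss; apply/seteqP; split=> // x [_ sx].
    case: (SN s Ss) => [Ns|s0]; first by exfalso; apply: S0; exists s.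
    by move: sx; rewrite s0.
  have SNleC : card_lt (S `&` N) C.
    split; first exact: card_le_trans (subset_card_le (@subIsetl _ _ _)) SleC.
    move=> h; apply: nCleS.
    exact: card_le_trans h (subset_card_le (@subIsetl _ _ _)).
  have [] := baseC A (S `&` N) rA.
  - by exists t0.
  - by move=> s [_ /NC].
  - by apply: sub_trivIset Sdisj; exact: subIsetl.
  - exact: SNleC.
  move=> h1 h2; have [/h1[s [Ss _] As]|/h2[B [rB BA BS]]] :=
      pselect (contains_region C (A `&` \bigcup_(D in S `&` N) D)).
    by exfalso; apply: noS; exists s.
  exists B; split=> // s Ss; case: (SN s Ss) => [Ns|->]; last exact: setI0.
  exact: BS.
have fN A : C A -> f A = set0 \/ N (f A).
  by move=> /fQ[[|[]]]; [left|right].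
have fdisj A B : C A -> C B -> f A !=set0 -> f B !=set0 ->
    f A `&` f B !=set0 -> f A = f B.
  move=> CA CB fA fB fAB; have [<-//|/eqP AB] := eqVneq A B.
  have [Sf'|Sf'] := trich _ _ CA CB AB.
    have [[f0|[_ /(_ _ Sf') f0]] _] := fQ _ CB.
      by move: fB => [x]; rewrite f0.
    by move: fAB => [x]; rewrite setIC f0.
  have [[f0|[_ /(_ _ Sf') f0]] _] := fQ _ CA.
    by move: fA => [x]; rewrite f0.
  by move: fAB => [x]; rewrite f0.
have Mdisj : trivIset (f @` C) id.
  move=> _ _ [A CA <-] [B CB <-] /= fAB; have [x [fx fx']] := fAB.
  by apply: fdisj => //; exists x.
(* Intersecting with [N] discards the empty values. *)
exists (f @` C `&` N); split.
- exact: subIsetr.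
- by apply: sub_trivIset Mdisj; exact: subIsetl.
- move=> A rA; have CA := rA.1.
  have [_ /(_ rA)] := fQ _ CA.
  case; first by move=> s /Sf[B CB <-]; case: (fN B CB); [right|left].
    by apply: sub_trivIset Mdisj; exact: Sf.
  move=> s sS As; exists s => //.
  have sM : (f @` C) s by case: sS => [->|/Sf//]; exists A.
  split=> //; case: (sM) => B CB sE; rewrite -sE.
  case: (fN B CB) => // f0; move: As => [D [_ [x Dx]] Ds].
  by have [_] := Ds x Dx; rewrite -sE f0.
Qed.

(* Banach's category theorem: localizing along a disjoint refinement, a union of
   singular sets lying in distinct members is again singular. *)
Lemma locally_meager (T : Type) (C : set (set T)) (G : set T) :
  category_base C ->
  (forall A, region C A ->
     exists D, [/\ region C D, D `<=` A & meager C (D `&` G)]) ->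
  meager C G.
Proof.
move=> baseC Gloc.
pose N := [set D | region C D /\ meager C (D `&` G)].
have [||M [MN Mdisj Mdense]] := @disjoint_refinement T C N baseC.
- by move=> D [].
- by move=> A /Gloc[D [rD DA mD]]; exists D.
have /choice[F FP] : forall D, exists F : nat -> set T, M D ->
    (forall n, singular C (F n)) /\ D `&` G = \bigcup_n F n.
  move=> D; have [/MN[_ [F sF DG]]|nMD] := pselect (M D); first by exists F.
  by exists (fun=> set0).
have sF : meager C (\bigcup_n \bigcup_(D in M) F D n).
  exists (fun n => \bigcup_(D in M) F D n) => // n A /Mdense[D MD [B rB BAD]].
  have [B' [rB' B'B B'F]] := (FP D MD).1 n B rB.
  exists B'; split=> //; first by move=> x /B'B /BAD[].
  apply/seteqP; split=> // x [B'x [D' MD' FD'x]].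
  have D'x : D' x.
    by have [] : (D' `&` G) x by rewrite (FP D' MD').2; exists n.
  have Dx : D x by have /BAD[] := B'B x B'x.
  have DD' : D = D' by apply: Mdisj => //; exists x.
  by rewrite -B'F; split=> //; rewrite DD'.
(* Every region has a subregion inside some member of [M], so this complement is even singular. *)
have sM : meager C (~` \bigcup_(D in M) D).
  exists (fun=> ~` \bigcup_(D in M) D); last by rewrite bigcup_const//; exists 0%N.
  move=> _ A /Mdense[D MD [B rB BAD]]; exists B; split=> //.
    by move=> x /BAD[].
  apply/seteqP; split=> // x [/BAD[_ Dx]]; apply.
  by exists D.
apply: meager_sub (meagerU sF sM) => x Gx.
have [[D MD Dx]|] := pselect ((\bigcup_(D in M) D) x); last by right.
left; have : (D `&` G) x by [].
by rewrite (FP D MD).2 => -[n _ Fx]; exists n => //; exists D.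
Qed.

(** Otherwise the Baire property leaves only its first alternative: every region has a subregion
    where [G] is meager, and Banach's theorem makes [G] meager. *)
Lemma abundant_baire_region (T : Type) (C : set (set T)) (G : set T) :
  category_base C -> baire C G -> abundant C G ->
  exists2 D, region C D & meager C (D `\` G).
Proof.
move=> baseC bG aG; apply: contrapT => noD; apply: aG.
apply: locally_meager => // A /bG[D [rD DA [mD|mD]]]; first by exists D.
by exfalso; apply: noD; exists D.
Qed.

Lemma baireI (T : Type) (C : set (set T)) (S S' : set T) :
  baire C S -> baire C S' -> baire C (S `&` S').
Proof.
move=> bS bS' A /bS[D [rD DA [mD|mD]]].
  by exists D; split=> //; left; apply: meager_sub mD => x [? []].
have [D' [rD' D'D [mD'|mD']]] := bS' D rD.
  exists D'; split=> //; first exact: subset_trans DA.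
  by left; apply: meager_sub mD' => x [? []].
exists D'; split=> //; first exact: subset_trans DA.
right; apply: meager_sub (meagerU mD mD') => x [D'x /not_andP[]] nx.
  by left; split=> //; exact: D'D.
by right.
Qed.

(** * Bernstein sets avoiding rational distances *)

(* Koenig's diagonal argument on [nat * nat -> bool]: it replaces the cardinal
   identity [k * aleph_0 = k]. *)
Lemma irrational_selection (R : realType) (h : (nat -> bool) -> R) (S : set R) :
  injective h -> ~ ([set: nat -> bool] #<= S)%card ->
  exists b, forall y, S y -> @irrational R `|h b - y|.
Proof.
move=> hinj nS; apply: contrapT => noB.
have /choice[w wP] : forall b, exists p : R * rat,
    S p.1 /\ h b = p.1 + ratr p.2.
  move=> b; apply: contrapT => nb; apply: noB; exists b => y Sy [q _ qE].
  apply: nb; have [hy|hy] := leP y (h b).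
    exists (y, q); split=> //=; rewrite qE ger0_norm ?subr_ge0//.
    by rewrite addrC subrK.
  exists (y, - q); split=> //=; rewrite rmorphN /= qE ltr0_norm ?subr_lt0//.
  by rewrite opprK addrC subrK.
(* Among the [b] whose rational has code [n], the point of [S] determines [b]; as [S] is too small,
   their [n]-th rows miss some sequence [z n]. *)
have /choice[z zP] : forall n, exists z : nat -> bool,
    forall b, pickle (w b).2 = n -> (fun k => b (pickle (n, k))) <> z.
  move=> n; apply: contrapT => nz.
  have /choice[B BP] : forall z : nat -> bool, exists b,
      pickle (w b).2 = n /\ (fun k => b (pickle (n, k))) = z.
    move=> z; apply: contrapT => nb; apply: nz; exists z => b bn bz.
    by apply: nb; exists b.
  apply: nS; apply: (@card_le_inj _ _ _ _ (fun z => (w (B z)).1)).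
    by move=> z _; exact: (wP (B z)).1.
  move=> z z' _ _ ww'; have BB' : B z = B z'.
    apply: hinj; rewrite (wP _).2 (wP (B z')).2 ww'; congr (_ + ratr _).
    by apply: (pcan_inj pickleK); rewrite (BP z).1 (BP z').1.
  by rewrite -(BP z).2 BB' (BP z').2.
(* The sequence with rows [z n] contradicts the choice of [z] at the code of its own rational. *)
pose b m := if @unpickle (nat * nat)%type m is Some (n, k) then z n k else false.
by apply: (zP _ b erefl); apply/funext => k; rewrite /b pickleK.
Qed.

(** The latest bit comes first, so that descending one level in the tree is a cons. *)
Fixpoint prefix (b : nat -> bool) (n : nat) : seq bool :=
  if n is m.+1 then b m :: prefix b m else [::].

(* [k] codes a binary tree of rationals, a Cantor set being the set of the limits
   along its branches; thus there are only continuum many codes. *)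
Definition coded_set (R : realType) (k : nat -> bool) : set R :=
  [set x | exists b : nat -> bool, forall n, exists2 q : rat,
    k (pickle (prefix b n.+1, q)) & `|x - ratr q| <= n.+1%:R^-1].

Lemma size_prefix b n : size (prefix b n) = n.
Proof. by elim: n => //= n ->. Qed.

(** The recursion runs over codes, so fewer than continuum many points are picked before each stage,
    while [h] offers continuum many candidates. [None] is the value at codes where no point has to
    be picked. *)
Lemma bernstein_ARD (R : realType) (E : set R) :
  exists F : set R, [/\ F `<=` E, ARD F &
    forall k (h : (nat -> bool) -> R), injective h ->
      (forall b, coded_set k (h b)) -> coded_set k `<=` E ->
      F `&` coded_set k !=set0].
Proof.
pose Q (k : nat -> bool) (S : set (option R)) (t : option R) :=
  (forall x, t = Some x -> [/\ E x, coded_set k x &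
    forall y, S (Some y) -> @irrational R `|x - y|]) /\
  ((exists2 h : (nat -> bool) -> R, injective h & forall b, coded_set k (h b)) ->
    coded_set k `<=` E -> exists x, t = Some x).
have [k S _ [_ nS]|f [S_ [fQ _ trich]]] :=
    @transfinite_choice (nat -> bool) (option R) setT Q.
  have [[[h hinj hk] kE]|no] := pselect
      ((exists2 h : (nat -> bool) -> R, injective h & forall b, coded_set k (h b))
      /\ coded_set k `<=` E); last first.
    by exists None; split=> // hk kE; case: no.
  have [|b bS] := @irrational_selection R h [set y | S (Some y)] hinj.
    move=> Sbig; apply: nS; apply: card_le_trans Sbig _.
    by apply: (@card_le_inj _ _ _ _ Some) => // x y _ _ [].
  exists (Some (h b)); split; last by exists (h b).
  by move=> _ [<-]; split=> //; exact: kE.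
exists [set x | exists k, f k = Some x]; split.
- by move=> x [k fk]; have [/(_ _ fk)[]] := fQ k I.
- move=> x y [k fk] [l fl] xy.
  have kl : k <> l by move=> kl; apply: xy; move: fk; rewrite kl fl => -[].
  have [Sl|Sk] := trich k l I I kl.
    have [/(_ _ fl)[_ _ lS] _] := fQ l I.
    by rewrite distrC; apply: lS; rewrite -fk.
  have [/(_ _ fk)[_ _ kS] _] := fQ k I.
  by apply: kS; rewrite -fl.
- move=> k h hinj hk kE; have [fk1 fk2] := fQ k I.
  have [|x fx] := fk2 _ kE; first by exists h.
  by exists x; split; [exists k|have [] := fk1 _ fx].
Qed.

(** * Cantor schemes of regions *)

Lemma diam_dist (R : realType) (A : set R) (e : R) :
  (diam A <= e%:E)%E -> forall x y, A x -> A y -> `|x - y| <= e.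
Proof.
move=> Ae x y Ax Ay; rewrite -lee_fin; apply: le_trans Ae.
by apply: ereal_sup_ubound; exists x, y.
Qed.

Lemma invSn_lt (R : realType) (d : R) :
  0 < d -> exists n : nat, n.+1%:R^-1 < d.
Proof. by move=> /ltr_add_invr[n]; rewrite add0r; exists n. Qed.

Lemma region_split (R : realType) (C : set (set R)) (A S : set R) (e : R) :
  perfect_base C -> region C A -> singular C S -> 0 < e ->
  exists B : bool -> set R,
    [/\ forall i, region C (B i), forall i, B i `<=` A,
        forall i, B i `&` S = set0, B true `&` B false = set0 &
        forall i x y, B i x -> B i y -> `|x - y| <= e].
Proof.
move=> [_ Cperf Cshrink] rA sS e0.
have shrink x d : A x -> 0 < d -> exists B, [/\ region C B, B `<=` A, B x &
    forall y z, B y -> B z -> `|y - z| <= d].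
  move=> Ax d0; have [A_ [rA_ A_A _ A_x A_d]] := Cshrink A x rA Ax.
  have [n nd] := invSn_lt d0.
  exists (A_ n); split=> // y z yA zA.
  by apply: le_trans (ltW nd); exact: diam_dist (A_d n) _ _ yA zA.
have [x Ax] := rA.2.
(* A perfect set has no isolated point, so [x] is not alone in [A]. *)
have [y [yx Ay _]] : exists y, [/\ y != x, A y & setT y].
  have [_ Alim] := Cperf A rA; move: (Ax); rewrite -{1}Alim => /(_ setT); apply.
  exact: filterT.
have yx0 : 0 < `|y - x| by rewrite normr_gt0 subr_eq0.
(* With thirds, a common point of the two small regions would put [x] and [y] within two thirds of
   their distance. *)
pose d := Num.min e (`|y - x| / 3).
have d0 : 0 < d by rewrite lt_min e0 divr_gt0.
have [B0 [rB0 B0A B0x B0d]] := shrink x d Ax d0.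
have [B1 [rB1 B1A B1y B1d]] := shrink y d Ay d0.
have [B0' [rB0' B0'B B0'S]] := sS _ rB0.
have [B1' [rB1' B1'B B1'S]] := sS _ rB1.
exists (fun i : bool => if i then B1' else B0'); split.
- by case.
- by case; [exact: subset_trans B1A|exact: subset_trans B0A].
- by case.
- apply/seteqP; split=> // z [/B1'B B1z /B0'B B0z].
  have := B1d _ _ B1y B1z; have := B0d _ _ B0z B0x.
  rewrite !le_min => /andP[_ h0] /andP[_ h1].
  have := ler_distD z y x; lra.
- case=> u v.
    move=> /B1'B Bu /B1'B Bv; apply: le_trans (B1d _ _ Bu Bv) _.
    by rewrite ge_min lexx.
  move=> /B0'B Bu /B0'B Bv; apply: le_trans (B0d _ _ Bu Bv) _.
  by rewrite ge_min lexx.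
Qed.

(** The splitting at level [n] avoids [S_ n], so the limit along a branch avoids them all. *)
Lemma cantor_scheme (R : realType) (C : set (set R)) (D : set R)
    (S_ : nat -> set R) :
  perfect_base C -> region C D -> (forall n, singular C (S_ n)) ->
  exists k (h : (nat -> bool) -> R),
    [/\ injective h, forall b, coded_set k (h b) &
        coded_set k `<=` D `\` \bigcup_n S_ n].
Proof.
move=> pC rD sS.
(* One half bounds the diameter of a region at level [n.+1], the other the distance from a point of
   it to the rational coding it. *)
pose e n : R := n.+1%:R^-1 / 2.
have e0 n : 0 < e n by rewrite divr_gt0 ?invr_gt0.
have eE n : n.+1%:R^-1 = e n + e n by rewrite /e -splitr.
have /choice[g gP] : forall p : set R * nat, exists B : bool -> set R,
    region C p.1 ->
    [/\ forall i, region C (B i), forall i, B i `<=` p.1,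
        forall i, B i `&` S_ p.2 = set0, B true `&` B false = set0 &
        forall i x y, B i x -> B i y -> `|x - y| <= e p.2].
  move=> [A n] /=; have [rA|nrA] := pselect (region C A); last by exists (fun=> A).
  by have [B ?] := region_split pC rA (sS n) (e0 n); exists B.
pose A := fix A (s : seq bool) := if s is i :: s' then g (A s', size s') i else D.
have rA s : region C (A s).
  by elim: s => //= i s IH; have [] := gP (A s, size s) IH.
have stepP s := gP (A s, size s) (rA s).
have AS s i : A (i :: s) `<=` A s by have [_ + _ _ _] := stepP s; exact.
have Adist s n x y : size s = n.+1 -> A s x -> A s y -> `|x - y| <= e n.
  by case: s => // i s [<-]; have [_ _ _ _] := stepP s; exact.
have Amono b m n : (m <= n)%N -> A (prefix b n) `<=` A (prefix b m).
  elim: n => [|n IH]; first by rewrite leqn0 => /eqP ->.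
  rewrite leq_eqVlt => /predU1P[->//|mn]; exact: subset_trans (AS _ _) (IH mn).
have /choice[c cP] : forall s, exists q : rat, forall n x,
    size s = n.+1 -> A s x -> `|x - ratr q| <= n.+1%:R^-1.
  (* The value at the root is arbitrary: [coded_set] reads only nonempty prefixes. *)
  move=> [|i s]; first by exists 0.
  have [a Aa] := (rA (i :: s)).2.
  have [|q] := @rat_in_itvoo R a (a + e (size s)); first by rewrite ltrDl.
  rewrite in_itv /= => /andP[aq qa]; exists q => n x [sn] Ax.
  have := Adist (i :: s) (size s) x a erefl Ax Aa.
  have aqe : `|a - ratr q| <= e (size s).
    by rewrite distrC ger0_norm ?subr_ge0 ?lerBlDl ltW.
  have := ler_distD a x (ratr q); move: aqe; rewrite -sn eE; lra.
have /choice[h hP] : forall b, exists x, forall n, A (prefix b n) x.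
  (* Points picked along a branch form a Cauchy sequence, and its limit stays in each region because
     perfect sets are closed. *)
  move=> b; have /choice[a aP] : forall n, exists x, A (prefix b n) x.
    by move=> n; exact: (rA _).2.
  have : cvg (a n @[n --> \oo]).
    apply: R_complete; apply: cauchy_exP => d d0.
    have [n nd] := invSn_lt d0.
    exists (a n.+1); exists n.+1 => // m nm; rewrite /ball /=.
    have := Adist _ n (a n.+1) (a m) (size_prefix b n.+1) (aP _) (Amono _ _ _ nm _ (aP m)).
    by move: nd (e0 n); rewrite eE; lra.
  move=> acvg; exists (lim (a n @[n --> \oo])) => n.
  have [_ Cperf _] := pC.
  apply: closed_cvg acvg => //; first exact: (Cperf _ (rA _)).1.
  by exists n => // m nm; apply: (Amono _ _ _ nm).
pose k m := if @unpickle (seq bool * rat)%type m is Some (s, q)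
            then q == c s else false.
(* At every level [x] and [h b] are within [n.+1%:R^-1] of the same rational, hence they
   coincide. *)
have codedE x : coded_set k x -> exists b, x = h b.
  move=> [b bx]; exists b; apply/eqP; rewrite -subr_eq0 -normr_eq0.
  apply/negPn/negP => nz.
  have d0 : 0 < `|x - h b| / 2 by rewrite divr_gt0// lt_def nz normr_ge0.
  have [n nd] := invSn_lt d0.
  have [q] := bx n; rewrite /k pickleK => /eqP -> xq.
  have := cP _ n (h b) (size_prefix b n.+1) (hP b _).
  have := ler_distD (ratr (c (prefix b n.+1))) x (h b).
  by rewrite [X in _ <= _ + X]distrC; move: nd xq; rewrite !(eE n); lra.
exists k, h; split.
- move=> b b' hh; apply/funext => n; apply/eqP/negPn/negP => bb'.
  (* At the first disagreement, the common value would lie in both disjoint children of one node. *)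
  have [m mP mmin] := ex_minnP (ex_intro (fun n => b n != b' n) n bb').
  have pE : prefix b m = prefix b' m.
    have : forall j, (j < m)%N -> b j = b' j.
      move=> j jm; apply/eqP/negPn/negP => /mmin; by rewrite leqNgt jm.
    elim: {mP mmin} m => //= m IH E; rewrite E// IH// => j jm.
    by apply: E; exact: leq_trans jm (leqnSn m).
  have := hP b m.+1; have := hP b' m.+1; rewrite -hh /= -pE.
  have [_ _ _ disj _] := stepP (prefix b m).
  have no z : g (A (prefix b m), size (prefix b m)) true z ->
      g (A (prefix b m), size (prefix b m)) false z -> False.
    by move=> zt zf; have : set0 z by rewrite -disj.
  move: mP; case: (b m); case: (b' m) => // _ ? ?; exact: (no (h b)).
- move=> b; exists b => n; exists (c (prefix b n.+1)).
    by rewrite /k pickleK.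
  exact: cP (size_prefix b n.+1) (hP b _).
- move=> x /codedE[b ->]; split; first exact: (hP b 0%N).
  move=> [n _ Sx]; have := hP b n.+1.
  have [_ _ noS _ _] := stepP (prefix b n).
  move=> /= Ax; have := noS (b n); rewrite /= size_prefix => nS.
  by have : set0 (h b) by rewrite -nS; split => //; move: Ax; rewrite size_prefix.
Qed.

Theorem theorem2p6 (R : realType) (C : set (set R)) (hC : perfect_base C)
    (E : set R) (hEa : abundant C E) (hEb : baire C E) :
  exists F : set R, [/\ F `<=` E, ARD F & full_subset C F E].
Proof.
have [baseC _ _] := hC.
have [F [FE FARD Fmeet]] := bernstein_ARD E.
exists F; split=> //; split=> // B bB aBE mBF.
have [D rD mD] := abundant_baire_region baseC (baireI bB hEb) aBE.
(* Merging both meager sets lets a single scheme avoid them together. *)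
have [S_ sS SE] := meagerU mD mBF.
have [k [h [hinj hk kD]]] := cantor_scheme hC rD sS.
have kBE x : coded_set k x -> B x /\ E x.
  move=> /kD[Dx nSx]; apply: contrapT => nBE.
  by apply: nSx; rewrite -SE; left.
have [x [Fx kx]] : F `&` coded_set k !=set0.
  by apply: Fmeet hinj hk _ => x /kBE[].
have [_] := kD x kx; apply; rewrite -SE; right.
by split=> //; have [] := kBE x kx.
Qed.
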